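(* For $\lambda,\mu\in\mathbb C$ and $k\in\mathbb N$, $$b^{(k)}_{\lambda,\mu}(\xi,\zeta)=p_k^{\lambda-\frac n2,\mu-\frac n2}(i\xi,i\zeta)=(-1)^k\,p_k^{\lambda-\frac n2,\mu-\frac n2}(\xi,\zeta).$$
   Context: On $\mathbb R^n\times\mathbb R^n$ let $\Delta_x,\Delta_y$ be the Laplacians in $x$ and $y$, and $\nabla_{xy}=\sum_{j=1}^n\frac{\partial^2}{\partial x_j\partial y_j}$. For $\lambda,\mu\in\mathbb C$ let $$F_{\lambda,\mu}=|x-y|^2\Delta_x\Delta_y+2(2\lambda-n+2)\sum_{j=1}^n(x_j-y_j)\frac{\partial}{\partial x_j}\Delta_y+2(2\mu-n+2)\sum_{j=1}^n(y_j-x_j)\frac{\partial}{\partial y_j}\Delta_x$$ $$\qquad+2\mu(2\mu-n+2)\Delta_x-2(2\lambda-n+2)(2\mu-n+2)\nabla_{xy}+2\lambda(2\lambda-n+2)\Delta_y .$$ Let $\mathrm{res}(f)(x)=f(x,x)$ for $f\in C^\infty(\mathbb R^n\times\mathbb R^n)$ and $B^{(k)}_{\lambda,\mu}=\mathrm{res}\circ F_{\lambda+k-1,\mu+k-1}\circ\dots\circ F_{\lambda,\mu}$ (with $B^{(0)}_{\lambda,\mu}=\mathrm{res}$). $B^{(k)}_{\lambda,\mu}$ has constant coefficients, and its symbol $b^{(k)}_{\lambda,\mu}(\xi,\zeta)$ is the polynomial with $B^{(k)}_{\lambda,\mu}(e^{i(x.\xi+y.\zeta)})(x)=b^{(k)}_{\lambda,\mu}(\xi,\zeta)e^{i(x.\xi+x.\zeta)}$.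 For $\alpha,\beta\in\mathbb C$ and $k\in\mathbb N$, $p_k^{\alpha,\beta}$ is the polynomial on $\mathbb R^n\times\mathbb R^n$ (homogeneous of degree $2k$) such that, for $\xi,\eta\neq0$, $$q\left(\frac{\partial}{\partial\xi}-\frac{\partial}{\partial\eta}\right)^k\big(|\xi|^{2(\alpha+k)}|\eta|^{2(\beta+k)}\big)=p_k^{\alpha,\beta}(\xi,\eta)\,|\xi|^{2\alpha}|\eta|^{2\beta},\qquad q\left(\frac{\partial}{\partial\xi}-\frac{\partial}{\partial\eta}\right)=\sum_{j=1}^n\left(\frac{\partial}{\partial\xi_j}-\frac{\partial}{\partial\eta_j}\right)^2 .$$ *)

(* Defs.v *)
From mathcomp Require Import all_boot all_order all_algebra complex.
From mathcomp Require Import mpoly.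
From mathcomp Require Import classical_sets reals topology normedtype derive.
From mathcomp Require Import sequences exp trigo.

Set Implicit Arguments.
Unset Strict Implicit.
Unset Printing Implicit Defensive.

Import Order.TTheory GRing.Theory Num.Theory.
Import numFieldNormedType.Exports.
Local Open Scope ring_scope.
Local Open Scope complex_scope.

(* R^n x R^n is the normed module 'rV[R]_n * 'rV[R]_n.  The library norm on
   'rV[R]_n is the sup norm, so the Euclidean norm is defined separately. *)
Definition dotv (R : realType) (n : nat) (x y : 'rV[R]_n) : R :=
  \sum_(j < n) x 0 j * y 0 j.

Definition enorm (R : realType) (n : nat) (x : 'rV[R]_n) : R :=
  Num.sqrt (dotv x x).

Definition cexp (R : realType) (z : R[i]) : R[i] :=
  (expR (complex.Re z) * cos (complex.Im z)) +i* (expR (complex.Re z) * sin (complex.Im z)).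

(* r ^ z for r > 0; the value for r <= 0 is meaningless and never used. *)
Definition cpow (R : realType) (r : R) (z : R[i]) : R[i] :=
  cexp (z * (ln r)%:C).

(* R[i] carries no normed R-module structure, so complex-valued functions are
   differentiated through their real and imaginary parts.  As for 'D_v, the
   value is only meaningful where f is differentiable: the operators below are
   total on arbitrary functions but are only applied to functions smooth near
   the point of evaluation. *)
Definition cderiv (R : realType) (V : normedModType R) (v : V)
    (f : V -> R[i]) (p : V) : R[i] :=
  ('D_v (fun q => complex.Re (f q)) p) +i* ('D_v (fun q => complex.Im (f q)) p).

Section Operators.
Context {R : realType} {n : nat}.

Local Notation E := ('rV[R]_n * 'rV[R]_n)%type.
Implicit Types (f : E -> R[i]) (j : 'I_n).

Definition dx j f : E -> R[i] := cderiv ((delta_mx 0 j, 0) : E) f.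
Definition dy j f : E -> R[i] := cderiv ((0, delta_mx 0 j) : E) f.

Definition lapx f : E -> R[i] := fun p => \sum_(j < n) dx j (dx j f) p.
Definition lapy f : E -> R[i] := fun p => \sum_(j < n) dy j (dy j f) p.
Definition nablaxy f : E -> R[i] := fun p => \sum_(j < n) dx j (dy j f) p.

Definition opF (lam mu : R[i]) f : E -> R[i] := fun p =>
  let x := p.1 in let y := p.2 in
  let cl := 2 * lam - n%:R + 2 in
  let cm := 2 * mu - n%:R + 2 in
  (enorm (x - y) ^+ 2)%:C * lapx (lapy f) p
  + 2 * cl * (\sum_(j < n) (x 0 j - y 0 j)%:C * dx j (lapy f) p)
  + 2 * cm * (\sum_(j < n) (y 0 j - x 0 j)%:C * dy j (lapx f) p)
  + 2 * mu * cm * lapx f p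
  - 2 * cl * cm * nablaxy f p
  + 2 * lam * cl * lapy f p.

Definition res f : 'rV[R]_n -> R[i] := fun x => f (x, x).

Fixpoint opFiter (k : nat) (lam mu : R[i]) f : E -> R[i] :=
  if k is k'.+1 then opF (lam + k'%:R) (mu + k'%:R) (opFiter k' lam mu f)
  else f.

Definition opB (k : nat) (lam mu : R[i]) f : 'rV[R]_n -> R[i] :=
  res (opFiter k lam mu f).

Definition dxy j f : E -> R[i] := fun p => dx j f p - dy j f p.

Definition opq f : E -> R[i] := fun p => \sum_(j < n) dxy j (dxy j f) p.

Definition pow2 (al be : R[i]) : E -> R[i] := fun p =>
  cpow (enorm p.1) (2 * al) * cpow (enorm p.2) (2 * be).

Definition planewave (xi zeta : 'rV[R]_n) : E -> R[i] := fun p =>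
  cexp ('i%C * (dotv p.1 xi + dotv p.2 zeta)%:C).

End Operators.

(* Complex polynomials on C^n x C^n: the first n indeterminates are the
   coordinates of the first vector, the last n those of the second. *)
Definition cpoly (R : realType) (n : nat) := {mpoly R[i][n + n]}.

Definition peval (R : realType) (n : nat) (p : cpoly R n)
    (u v : 'rV[R[i]]_n) : R[i] :=
  p.@[fun l => row_mx u v 0 l].

Definition cvec (R : realType) (n : nat) (x : 'rV[R]_n) : 'rV[R[i]]_n :=
  map_mx (real_complex R) x.

Definition is_pk (R : realType) (n : nat) (al be : R[i]) (k : nat)
    (p : cpoly R n) : Prop :=
  p \is (2 * k).-homog /\
  forall xi eta : 'rV[R]_n, xi != 0 -> eta != 0 ->
    iter k opq (pow2 (al + k%:R) (be + k%:R)) (xi, eta)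
    = peval p (cvec xi) (cvec eta) * pow2 al be (xi, eta).

Definition is_symbol (R : realType) (n : nat)
    (B : ('rV[R]_n * 'rV[R]_n -> R[i]) -> 'rV[R]_n -> R[i])
    (b : cpoly R n) : Prop :=
  forall xi zeta x : 'rV[R]_n,
    B (planewave xi zeta) x
    = peval b (cvec xi) (cvec zeta) * planewave xi zeta (x, x).

(* "The polynomial such that": xget picks a polynomial with the property.  For
   n > 0 it exists and is unique (polynomials over an infinite field agreeing
   on real points xi, eta != 0 are equal), so the default 0 is never used. *)
Definition pk (R : realType) (n : nat) (al be : R[i]) (k : nat) : cpoly R n :=
  xget 0 [set p | is_pk al be k p]%classic.

Definition symb (R : realType) (n : nat) (lam mu : R[i]) (k : nat) :
    cpoly R n :=
  xget 0 [set b | is_symbol (opB k lam mu) b]%classic.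

(* Main.v *)
Require Import Defs.
From HB Require Import structures.
From mathcomp Require Import all_boot all_order all_algebra complex.
From mathcomp Require Import mpoly ring.
From mathcomp Require Import classical_sets reals topology normedtype derive.
From mathcomp Require Import boolp functions realfun sequences exp trigo.

Set Implicit Arguments.
Unset Strict Implicit.
Unset Printing Implicit Defensive.

Import Order.TTheory GRing.Theory Num.Theory.
Import numFieldNormedType.Exports.
Local Open Scope ring_scope.
Local Open Scope complex_scope.

(** Put D_j = d/dxi_j - d/dzeta_j, q(D) = D_1^2 + ... + D_n^2, w = x - y and
    e = exp(i(x.xi + y.zeta)).  Everything rests on one differential operator
    G = G_(lam,mu) in the variables (xi, zeta), formed from multiplications by xi_j
    and zeta_j and from the D_j ([wordG]), which governs both families.

    Symbols.  Since w_j e = - i D_j e, d/dx_j e = i xi_j e and d/dy_j e = i zeta_j e, the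
    function F e can be written as G e.  Now F acts in (x, y) and G in (xi, zeta), so the
    two kinds of operators commute, and F_(k-1) ... F_0 e = G_0 ... G_(k-1) e where the
    index j stands for the parameters (lam + j, mu + j).  On the diagonal e depends on
    xi + zeta only, hence is annihilated by the D_j, and the symbol is the polynomial
    G_0 ... G_(k-1) 1 ([is_symbol_opB]).  All this is carried out on polynomials: the
    coefficients of F depend on w only, so F preserves the functions Q e with Q
    polynomial in (w, xi, zeta), and dividing by e turns the operators above into
    operators on such amplitudes Q, which still commute ([ampG_iter_ampF]).

    The p_k.  By the product rule,
      q(D)(f |xi|^(2(a+1)) |zeta|^(2(b+1))) = - (G f) |xi|^(2a) |zeta|^(2b)
    with a = lam - n/2 and b = mu - n/2 ([opq_polypow]).  Iterating from f = 1 gives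
    p_k = (-1)^k G_0 ... G_(k-1) 1 ([is_pk_pk_poly]), that is, (-1)^k times the symbol.
    As p_k is homogeneous of degree 2k, replacing (xi, zeta) by (i xi, i zeta)
    multiplies it by i^(2k) = (-1)^k, which gives both equalities.

    The identity defining p_k only prescribes its values where xi and eta are nonzero.
    The values at the remaining real points follow by restriction to a line
    ([is_pk_unique]). *)

(** * Directional derivatives of complex-valued functions *)

Section DirectionalDerivatives.
Context {R : realType} {V : normedModType R}.
Implicit Types (v p : V) (g : V -> R) (f h : V -> R[i]).

(** Reduces directional derivatives to one real variable, where the chain rule for
    real functions is available. *)
Lemma is_derive_lineP v p g (d : R) :
  is_derive p v g d <-> is_derive (0 : R) (1 : R) (fun t : R => g (t *: v + p)) d.
Proof.
suff dE : 'D_1 (fun t : R => g (t *: v + p)) (0 : R) = 'D_v g p.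
  split=> -[dg <-]; split; rewrite ?dE //; first exact/(derivable1P g p v).
  exact/(derivable1P g p v).
rewrite /derive; set g1 := fun t => t^-1 *: _; set g2 := fun t => t^-1 *: _.
suff -> : g1 = g2 by [].
by apply/funext => t; rewrite /g1 /g2 /= addr0 scale0r add0r [_%:A]mulr1.
Qed.

Lemma is_derive_comp1 v p (k : R -> R) g (a b : R) :
  is_derive (g p) 1 k a -> is_derive p v g b ->
  is_derive p v (fun q => k (g q)) (a * b).
Proof.
move=> dk dg; apply/is_derive_lineP.
apply: (@is_derive1_comp _ k (fun t : R => g (t *: v + p))).
  by rewrite scale0r add0r.
exact/is_derive_lineP.
Qed.

Lemma is_derive_linear v p g :
  (forall (t : R) q r, g (t *: q + r) = t * g q + g r) -> is_derive p v g (g v).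
Proof.
move=> glin; apply/is_derive_lineP.
pose k : R -> R := (id : R -> R) * cst (g v) + cst (g p).
rewrite (_ : (fun _ => _) = k); last by apply/funext => t /=; rewrite glin.
have := is_deriveD (is_deriveM (is_derive_id (0 : R) (1 : R))
           (is_derive_cst (g v) _ _)) (is_derive_cst (g p) _ _).
move/is_derive_eq; apply.
by rewrite /= scaler0 add0r addr0 [LHS]mulr1.
Qed.

(** Unlike the value [cderiv], this carries the existence of the derivative, which the
    sum and product rules need. *)
Definition is_cderiv v f p (d : R[i]) : Prop :=
  is_derive p v (fun q => complex.Re (f q)) (complex.Re d) /\
  is_derive p v (fun q => complex.Im (f q)) (complex.Im d).

Lemma cderivE v f p d : is_cderiv v f p d -> cderiv v f p = d.
Proof. by case: d => a b [/= [_ da] [_ db]]; rewrite /cderiv da db. Qed.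

Lemma is_cderiv_eq v f p d d' : is_cderiv v f p d -> d = d' -> is_cderiv v f p d'.
Proof. by move=> ? <-. Qed.

Lemma near_cderiv v f h p :
  (\forall q \near p, f q = h q) -> cderiv v f p = cderiv v h p.
Proof.
by move=> fh; rewrite /cderiv; congr Complex; apply: near_eq_derive;
  apply: filterS fh => q ->.
Qed.

Lemma is_cderiv_cst v p (c : R[i]) : is_cderiv v (fun=> c) p 0.
Proof. by split; apply: is_derive_cst. Qed.

Lemma ReD (x y : R[i]) : complex.Re (x + y) = complex.Re x + complex.Re y.
Proof. by case: x; case: y. Qed.

Lemma ImD (x y : R[i]) : complex.Im (x + y) = complex.Im x + complex.Im y.
Proof. by case: x; case: y. Qed.

Lemma ReM (x y : R[i]) : complex.Re (x * y) =
  complex.Re x * complex.Re y - complex.Im x * complex.Im y.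
Proof. by case: x; case: y. Qed.

Lemma ImM (x y : R[i]) : complex.Im (x * y) =
  complex.Re x * complex.Im y + complex.Im x * complex.Re y.
Proof. by case: x; case: y. Qed.

Lemma is_cderivD v p f h c d : is_cderiv v f p c -> is_cderiv v h p d ->
  is_cderiv v (fun q => f q + h q) p (c + d).
Proof.
move=> [fr fi] [hr hi]; split.
  have := is_deriveD fr hr; rewrite -ReD; congr is_derive.
  by apply/funext => q; rewrite ReD.
have := is_deriveD fi hi; rewrite -ImD; congr is_derive.
by apply/funext => q; rewrite ImD.
Qed.

Lemma is_cderivM v p f h c d : is_cderiv v f p c -> is_cderiv v h p d ->
  is_cderiv v (fun q => f q * h q) p (c * h p + f p * d).
Proof.
move=> [fr fi] [hr hi]; split.
  have := is_deriveB (is_deriveM fr hr) (is_deriveM fi hi).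
  rewrite (_ : _ - _ = fun q => complex.Re (f q * h q)); last first.
    by apply/funext => q; rewrite ReM.
  move/is_derive_eq; apply; rewrite ReD !ReM /GRing.scale /=; ring.
have := is_deriveD (is_deriveM fr hi) (is_deriveM fi hr).
rewrite (_ : _ + _ = fun q => complex.Im (f q * h q)); last first.
  by apply/funext => q; rewrite ImM.
move/is_derive_eq; apply; rewrite ImD !ImM /GRing.scale /=; ring.
Qed.

Lemma is_cderiv_real v p g (d : R) :
  is_derive p v g d -> is_cderiv v (fun q => (g q)%:C) p d%:C.
Proof. by move=> dg; split=> //=; apply: is_derive_cst. Qed.

Lemma is_cderiv_cexp v p f d : is_cderiv v f p d ->
  is_cderiv v (fun q => cexp (f q)) p (d * cexp (f p)).
Proof.
move=> [fr fi].
have de := is_derive_comp1 (is_derive_expR _) fr.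
have dc := is_derive_comp1 (is_derive_cos _) fi.
have ds := is_derive_comp1 (is_derive_sin _) fi.
split.
  have := is_deriveM de dc; move/is_derive_eq; apply.
  rewrite ReM /GRing.scale /=; ring.
have := is_deriveM de ds; move/is_derive_eq; apply.
rewrite ImM /GRing.scale /=; ring.
Qed.

End DirectionalDerivatives.

(** * The operators F and G as words in abstract generators *)

Section OperatorWords.
Context {K : comNzRingType} {n : nat}.

(** For families of first-order derivatives, [dotop X X] is a Laplacian. *)
Definition dotop (A : lmodType K) (X Y : 'I_n -> A -> A) (f : A) : A :=
  \sum_(j < n) X j (Y j f).

(** F with x_j - y_j, d/dx_j, d/dy_j replaced by operators W_j, X_j, Y_j; the sign of the
    third term accounts for the factor y_j - x_j. *)
Definition wordF (A : lmodType K) (W X Y : 'I_n -> A -> A) (lam mu : K) (f : A) : A :=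
  let cl := 2 * lam - n%:R + 2 in
  let cm := 2 * mu - n%:R + 2 in
  dotop W W (dotop X X (dotop Y Y f))
  + (2 * cl) *: dotop W X (dotop Y Y f)
  - (2 * cm) *: dotop W Y (dotop X X f)
  + (2 * mu * cm) *: dotop X X f
  - (2 * cl * cm) *: dotop X Y f
  + (2 * lam * cl) *: dotop Y Y f.

(** The operator in (xi, zeta) such that F e = G e, where U_j and Z_j stand for the
    multiplications by xi_j and zeta_j: each X_j of F became i U_j, each Y_j became
    i Z_j and each W_j became - i D_j, with the W_j applied first. *)
Definition wordG (A : lmodType K) (U Z D : 'I_n -> A -> A) (lam mu : K) (f : A) : A :=
  let cl := 2 * lam - n%:R + 2 in
  let cm := 2 * mu - n%:R + 2 in
  - dotop U U (dotop Z Z (dotop D D f))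
  - (2 * cl) *: dotop Z Z (dotop U D f)
  + (2 * cm) *: dotop U U (dotop Z D f)
  - (2 * mu * cm) *: dotop U U f
  + (2 * cl * cm) *: dotop U Z f
  - (2 * lam * cl) *: dotop Z Z f.

(** G_0 (G_1 (... (G_(k-1) f))): the parameters increase towards the inside, whereas they
    increase towards the outside in [opFiter], because exchanging the F_j for the G_j
    reverses the order of composition. *)
Fixpoint wordG_iter (A : lmodType K) (U Z D : 'I_n -> A -> A) (lam mu : K)
    (k : nat) (f : A) : A :=
  if k is k'.+1 then
    wordG_iter U Z D lam mu k' (wordG U Z D (lam + k'%:R) (mu + k'%:R) f)
  else f.

(** Corresponding terms have opposite coefficients, because each of them contains
    i^2 = -1 an odd number of times once the factors i and - i are collected. *)
Lemma wordF_eq_wordG (A : lmodType K) (W X Y U Z D : 'I_n -> A -> A) (lam mu : K) f :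
  dotop W W (dotop X X (dotop Y Y f)) = - dotop U U (dotop Z Z (dotop D D f)) ->
  dotop W X (dotop Y Y f) = - dotop Z Z (dotop U D f) ->
  dotop W Y (dotop X X f) = - dotop U U (dotop Z D f) ->
  dotop X X f = - dotop U U f -> dotop X Y f = - dotop U Z f ->
  dotop Y Y f = - dotop Z Z f ->
  wordF W X Y lam mu f = wordG U Z D lam mu f.
Proof.
by rewrite /wordF /wordG => -> -> -> -> -> ->; rewrite !scalerN !opprK.
Qed.

Section Intertwining.
Variables (A B : lmodType K) (h : {linear A -> B}).

(** Serves three purposes: commutation of F and G (h is a generator of one of them),
    restriction to w = 0, and homogeneity of G (h is a scaling). *)
Definition intertwines (S : A -> A) (T : B -> B) := forall f, h (S f) = T (h f).

Lemma intertwines_dotop (X Y : 'I_n -> A -> A) (X' Y' : 'I_n -> B -> B) :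
  (forall j, intertwines (X j) (X' j)) -> (forall j, intertwines (Y j) (Y' j)) ->
  intertwines (dotop X Y) (dotop X' Y').
Proof.
by move=> hX hY f; rewrite /dotop linear_sum; apply: eq_bigr => j _; rewrite hX hY.
Qed.

Lemma intertwines_wordF (W X Y : 'I_n -> A -> A) (W' X' Y' : 'I_n -> B -> B) lam mu :
  (forall j, intertwines (W j) (W' j)) -> (forall j, intertwines (X j) (X' j)) ->
  (forall j, intertwines (Y j) (Y' j)) ->
  intertwines (wordF W X Y lam mu) (wordF W' X' Y' lam mu).
Proof.
move=> hW hX hY f; rewrite /wordF.
have [hWW hXX hYY] := And3 (intertwines_dotop hW hW) (intertwines_dotop hX hX)
  (intertwines_dotop hY hY).
have [hWX hWY hXY] := And3 (intertwines_dotop hW hX) (intertwines_dotop hW hY)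
  (intertwines_dotop hX hY).
by rewrite !(linearD, linearN, linearZ) /= !(hWW, hXX, hYY, hWX, hWY, hXY).
Qed.

Lemma intertwines_wordG (U Z D : 'I_n -> A -> A) (U' Z' D' : 'I_n -> B -> B) lam mu :
  (forall j, intertwines (U j) (U' j)) -> (forall j, intertwines (Z j) (Z' j)) ->
  (forall j, intertwines (D j) (D' j)) ->
  intertwines (wordG U Z D lam mu) (wordG U' Z' D' lam mu).
Proof.
move=> hU hZ hD f; rewrite /wordG.
have [hUU hZZ hDD] := And3 (intertwines_dotop hU hU) (intertwines_dotop hZ hZ)
  (intertwines_dotop hD hD).
have [hUZ hUD hZD] := And3 (intertwines_dotop hU hZ) (intertwines_dotop hU hD)
  (intertwines_dotop hZ hD).
by rewrite !(linearD, linearN, linearZ) /= !(hUU, hZZ, hDD, hUZ, hUD, hZD).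
Qed.

Lemma intertwines_wordG_iter (U Z D : 'I_n -> A -> A) (U' Z' D' : 'I_n -> B -> B)
    lam mu k :
  (forall j, intertwines (U j) (U' j)) -> (forall j, intertwines (Z j) (Z' j)) ->
  (forall j, intertwines (D j) (D' j)) ->
  intertwines (wordG_iter U Z D lam mu k) (wordG_iter U' Z' D' lam mu k).
Proof.
move=> hU hZ hD; elim: k => [|k IHk] f //=.
by rewrite IHk (intertwines_wordG _ _ hU hZ hD).
Qed.

End Intertwining.

Lemma dotop_is_linear (A : lmodType K) (X Y : 'I_n -> {linear A -> A}) :
  linear (dotop X Y).
Proof.
move=> a f g; rewrite /dotop scaler_sumr -big_split; apply: eq_bigr => j _ /=.
by rewrite !linearP.
Qed.

HB.instance Definition _ (A : lmodType K) (X Y : 'I_n -> {linear A -> A}) :=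
  GRing.isLinear.Build K A A *:%R (dotop X Y) (dotop_is_linear X Y).

Lemma wordF_is_linear (A : lmodType K) (W X Y : 'I_n -> {linear A -> A}) lam mu :
  linear (wordF W X Y lam mu).
Proof.
pose cl := 2 * lam - n%:R + 2; pose cm := 2 * mu - n%:R + 2.
exact: (linearP ((dotop W W \o (dotop X X \o dotop Y Y))
  \+ ((2 * cl) \*: (dotop W X \o dotop Y Y))
  \- ((2 * cm) \*: (dotop W Y \o dotop X X))
  \+ ((2 * mu * cm) \*: dotop X X)
  \- ((2 * cl * cm) \*: dotop X Y)
  \+ ((2 * lam * cl) \*: dotop Y Y))).
Qed.

HB.instance Definition _ (A : lmodType K) (W X Y : 'I_n -> {linear A -> A}) lam mu :=
  GRing.isLinear.Build K A A *:%R (wordF W X Y lam mu) (wordF_is_linear W X Y lam mu).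

End OperatorWords.

(** * Polynomials in several variables *)

Section Polynomials.
Context {K : comNzRingType} {m : nat}.
Implicit Types (p q : {mpoly K[m]}) (i j : 'I_m).

(** Adapted to ring morphisms and derivations, which are determined by their values on
    constants and variables. *)
Lemma mpoly_gen_ind (P : {mpoly K[m]} -> Prop) :
  (forall c, P c%:MP) -> (forall i, P 'X_i) ->
  (forall p q, P p -> P q -> P (p + q)) -> (forall p q, P p -> P q -> P (p * q)) ->
  forall p, P p.
Proof.
move=> PC PX PD PM p; have P1 : P 1 by rewrite -mpolyC1; apply: PC.
rewrite (mpolyE p); apply: big_ind;
  [by rewrite -mpolyC0; apply: PC | exact: PD | move=> u _].
rewrite -mul_mpolyC; apply: (PM); first exact: PC.
rewrite mpolyXE_id; apply: big_ind; [exact: P1 | exact: PM | move=> i _].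
by elim: (u i) => [|d IHd]; rewrite ?expr0 // exprS; apply: PM.
Qed.

Lemma mderivXU i j : ('X_i)^`M(j) = (i == j)%:R :> {mpoly K[m]}.
Proof.
rewrite mderivX mnm1E; case: eqP => [->|_]; last by rewrite scale0r.
by rewrite -{1}[U_(j)%MM]add0m addmK mpolyX0 scale1r.
Qed.

Lemma dhomogXU i : ('X_i : {mpoly K[m]}) \is 1.-homog.
Proof. by rewrite dhomogX /= mdeg1. Qed.

(** At d = 0 the truncation is harmless: the derivative vanishes, and zero is homogeneous
    of every degree. *)
Lemma dhomog_mderiv d p i : p \is d.-homog -> p^`M(i) \is d.-1.-homog.
Proof.
move/dhomogP=> hp; apply/dhomogP => u; rewrite mcoeff_msupp mcoeff_mderiv => nz.
have /hp <- : (u + U_(i))%MM \in msupp p.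
  by rewrite mcoeff_msupp; apply: contraNneq nz => ->; rewrite mul0rn.
by rewrite /= mdegD mdeg1 addn1.
Qed.

Lemma mderiv_dhomog0 p i : p \is 0.-homog -> p^`M(i) = 0.
Proof.
move=> hp; apply/mpolyP => u; rewrite mcoeff_mderiv mcoeff0.
by rewrite (dhomog_nemf_coeff hp) ?mul0rn //= mdegD mdeg1 addn1.
Qed.

Lemma dhomogM_mderiv d p q i :
  q \is 1.-homog -> p \is d.-homog -> q * p^`M(i) \is d.-homog.
Proof.
case: d => [|d] hq hp; first by rewrite mderiv_dhomog0 // mulr0 rpred0.
by have := dhomogM hq (dhomog_mderiv i hp).
Qed.

End Polynomials.

(** * Amplitudes of plane waves *)

Section Amplitudes.
Context {R : realType} {n : nat}.
Local Notation C := R[i].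
Local Notation W := {mpoly C[n + (n + n)]}.
Local Notation iw := (@lshift n (n + n)).
Local Notation ixi j := (@rshift n (n + n) (@lshift n n j)).
Local Notation ize j := (@rshift n (n + n) (@rshift n n j)).

(** The indeterminates are the coordinates of w = x - y, then of xi, then of zeta.  These
    are the actions on Q of x_j - y_j, d/dx_j and d/dy_j on Q(x - y, xi, zeta) e, after
    division by e. *)
Definition ampW (j : 'I_n) (f : W) : W := 'X_(iw j) * f.
Definition ampX (j : 'I_n) (f : W) : W := f^`M(iw j) + 'i%C%:MP * ('X_(ixi j) * f).
Definition ampY (j : 'I_n) (f : W) : W := 'i%C%:MP * ('X_(ize j) * f) - f^`M(iw j).

(** The generators of G, after division by e: as D_j e = i w_j e, the operator D_j acts on
    amplitudes as D_j + i w_j. *)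
Definition ampU (j : 'I_n) (f : W) : W := 'X_(ixi j) * f.
Definition ampZ (j : 'I_n) (f : W) : W := 'X_(ize j) * f.
Definition ampD (j : 'I_n) (f : W) : W :=
  f^`M(ixi j) - f^`M(ize j) + 'i%C%:MP * ('X_(iw j) * f).

Lemma ampW_is_linear j : linear (ampW j).
Proof. by move=> a f g; rewrite /ampW mulrDr scalerAr. Qed.
HB.instance Definition _ j := GRing.isLinear.Build C W W *:%R (ampW j) (ampW_is_linear j).

Lemma ampU_is_linear j : linear (ampU j).
Proof. by move=> a f g; rewrite /ampU mulrDr scalerAr. Qed.
HB.instance Definition _ j := GRing.isLinear.Build C W W *:%R (ampU j) (ampU_is_linear j).

Lemma ampZ_is_linear j : linear (ampZ j).
Proof. by move=> a f g; rewrite /ampZ mulrDr scalerAr. Qed.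
HB.instance Definition _ j := GRing.isLinear.Build C W W *:%R (ampZ j) (ampZ_is_linear j).

Lemma ampX_is_linear j : linear (ampX j).
Proof.
move=> a f g; rewrite /ampX mderivD mderivZ -!(mul_mpolyC a); ring.
Qed.
HB.instance Definition _ j := GRing.isLinear.Build C W W *:%R (ampX j) (ampX_is_linear j).

Lemma ampY_is_linear j : linear (ampY j).
Proof.
move=> a f g; rewrite /ampY mderivD mderivZ -!(mul_mpolyC a); ring.
Qed.
HB.instance Definition _ j := GRing.isLinear.Build C W W *:%R (ampY j) (ampY_is_linear j).

Lemma ampD_is_linear j : linear (ampD j).
Proof.
move=> a f g; rewrite /ampD !mderivD !mderivZ -!(mul_mpolyC a); ring.
Qed.
HB.instance Definition _ j := GRing.isLinear.Build C W W *:%R (ampD j) (ampD_is_linear j).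

Lemma amp_indices :
  (forall j l : 'I_n, (iw j == iw l) = (j == l)) *
  (forall j l : 'I_n, (ixi j == ixi l) = (j == l)) *
  (forall j l : 'I_n, (ize j == ize l) = (j == l)) *
  (forall j l : 'I_n, (iw j == ixi l) = false) *
  (forall j l : 'I_n, (iw j == ize l) = false) *
  (forall j l : 'I_n, (ixi j == iw l) = false) *
  (forall j l : 'I_n, (ize j == iw l) = false) *
  (forall j l : 'I_n, (ixi j == ize l) = false) *
  (forall j l : 'I_n, (ize j == ixi l) = false).
Proof.
by do !split; move=> j l; rewrite ?eq_shift.
Qed.

(** The two nonzero brackets [d/dw_j, i w_j] and [i xi_j, D_j] = - i cancel, as they must:
    before division by e, the operators d/dx_j and D_l act on different variables. *)
Lemma ampX_ampD j l f : ampX j (ampD l f) = ampD l (ampX j f).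
Proof.
rewrite /ampX /ampD
  !(mderivD, mderivN, mderiv_mulC, mderivM, mderivXU, amp_indices) ?mulr0n.
rewrite !(mderiv_comm _ (iw j)) eq_sym; ring.
Qed.

Lemma ampY_ampD j l f : ampY j (ampD l f) = ampD l (ampY j f).
Proof.
rewrite /ampY /ampD
  !(mderivD, mderivN, mderiv_mulC, mderivM, mderivXU, amp_indices) ?mulr0n.
rewrite !(mderiv_comm _ (iw j)) eq_sym; ring.
Qed.

Lemma ampW_ampD j l f : ampW j (ampD l f) = ampD l (ampW j f).
Proof.
rewrite /ampW /ampD !(mderiv_mulC, mderivM, mderivXU, amp_indices) ?mulr0n; ring.
Qed.

Lemma ampX_ampU j l f : ampX j (ampU l f) = ampU l (ampX j f).
Proof.
rewrite /ampX /ampU !(mderiv_mulC, mderivM, mderivXU, amp_indices) ?mulr0n; ring.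
Qed.

Lemma ampX_ampZ j l f : ampX j (ampZ l f) = ampZ l (ampX j f).
Proof.
rewrite /ampX /ampZ !(mderiv_mulC, mderivM, mderivXU, amp_indices) ?mulr0n; ring.
Qed.

Lemma ampY_ampU j l f : ampY j (ampU l f) = ampU l (ampY j f).
Proof.
rewrite /ampY /ampU !(mderiv_mulC, mderivM, mderivXU, amp_indices) ?mulr0n; ring.
Qed.

Lemma ampY_ampZ j l f : ampY j (ampZ l f) = ampZ l (ampY j f).
Proof.
rewrite /ampY /ampZ !(mderiv_mulC, mderivM, mderivXU, amp_indices) ?mulr0n; ring.
Qed.

End Amplitudes.

Section Exchange.
Context {R : realType} {n : nat}.
Local Notation C := R[i].
Local Notation W := {mpoly C[n + (n + n)]}.
Local Notation iw := (@lshift n (n + n)).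
Local Notation ixi j := (@rshift n (n + n) (@lshift n n j)).
Local Notation ize j := (@rshift n (n + n) (@rshift n n j)).
Local Notation opW := (@ampW R n).
Local Notation opX := (@ampX R n).
Local Notation opY := (@ampY R n).
Local Notation opU := (@ampU R n).
Local Notation opZ := (@ampZ R n).
Local Notation opD := (@ampD R n).
Local Notation ampF := (wordF opW opX opY).
Local Notation ampG := (wordG opU opZ opD).
Local Notation ampG_iter := (wordG_iter opU opZ opD).

(** Every generator of F commutes with every generator of G. *)
Lemma ampG_iter_ampF lam mu lam' mu' k f :
  ampF lam mu (ampG_iter lam' mu' k f) = ampG_iter lam' mu' k (ampF lam mu f).
Proof.
pose lW : 'I_n -> {linear W -> W} := ampW; pose lX : 'I_n -> {linear W -> W} := ampX.
pose lY : 'I_n -> {linear W -> W} := ampY.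
pose h : {linear W -> W} := wordF lW lX lY lam mu.
suff: intertwines h (ampG_iter lam' mu' k) (ampG_iter lam' mu' k) by apply.
apply: intertwines_wordG_iter => j g; rewrite /h /=; apply/esym.
- suff: intertwines (ampU j : {linear W -> W}) (ampF lam mu) (ampF lam mu) by apply.
  apply: intertwines_wordF => l q /=; [exact: mulrCA | exact/esym/ampX_ampU |].
  exact/esym/ampY_ampU.
- suff: intertwines (ampZ j : {linear W -> W}) (ampF lam mu) (ampF lam mu) by apply.
  apply: intertwines_wordF => l q /=; [exact: mulrCA | exact/esym/ampX_ampZ |].
  exact/esym/ampY_ampZ.
- suff: intertwines (ampD j : {linear W -> W}) (ampF lam mu) (ampF lam mu) by apply.
  apply: intertwines_wordF => l q /=; [|exact/esym/ampX_ampD | exact/esym/ampY_ampD].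
  exact/esym/ampW_ampD.
Qed.

Local Notation dotp x y := (\sum_(j < n) x j * y j).
Local Notation w := (fun j => 'X_(iw j) : W).
Local Notation u := (fun j => 'X_(ixi j) : W).
Local Notation z := (fun j => 'X_(ize j) : W).
Local Notation im := ('i%C%:MP : W).

Lemma imM : im * im = -1.
Proof. by rewrite -mpolyCM -expr2 sqr_i mpolyCN mpolyC1. Qed.

(** On such amplitudes [ampX] and [ampY] are multiplications by i xi_j and i zeta_j. *)
Definition free_of_w (g : W) := forall j : 'I_n, g^`M(iw j) = 0.

Lemma free_of_wM g h : free_of_w g -> free_of_w h -> free_of_w (g * h).
Proof. by move=> g0 h0 j; rewrite mderivM g0 h0 mulr0 mul0r addr0. Qed.

Lemma free_of_wC c : free_of_w c%:MP.
Proof. by move=> j; rewrite mderivC. Qed.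

Lemma free_of_wu j : free_of_w (u j).
Proof. by move=> l; rewrite mderivXU amp_indices. Qed.

Lemma free_of_wz j : free_of_w (z j).
Proof. by move=> l; rewrite mderivXU amp_indices. Qed.

Lemma ampX_free j g : free_of_w g -> ampX j g = im * (u j * g).
Proof. by move=> g0; rewrite /ampX g0 add0r. Qed.

Lemma ampY_free j g : free_of_w g -> ampY j g = im * (z j * g).
Proof. by move=> g0; rewrite /ampY g0 subr0. Qed.

Lemma dotopE (A B : 'I_n -> W -> W) (c : W) (a b : 'I_n -> W) (g : W) :
  (forall j, A j (B j g) = c * (a j * b j) * g) -> dotop A B g = c * dotp a b * g.
Proof.
by move=> AB; rewrite /dotop mulr_sumr mulr_suml; apply: eq_bigr => j _; rewrite AB.
Qed.

Lemma dotop_free g : free_of_w g ->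
  [/\ dotop opX opX g = - 1 * dotp u u * g,
      dotop opX opY g = - 1 * dotp u z * g,
      dotop opY opY g = - 1 * dotp z z * g,
      dotop opW opX g = im * dotp w u * g &
      dotop opW opY g = im * dotp w z * g].
Proof.
move=> g0.
have gu j : free_of_w (im * (u j * g)).
  exact: (free_of_wM (free_of_wC _) (free_of_wM (free_of_wu j) g0)).
have gz j : free_of_w (im * (z j * g)).
  exact: (free_of_wM (free_of_wC _) (free_of_wM (free_of_wz j) g0)).
split; apply: dotopE => j; rewrite ?(ampX_free j g0, ampY_free j g0).
- by rewrite ampX_free // -imM; ring.
- by rewrite ampX_free // -imM; ring.
- by rewrite ampY_free // -imM; ring.
- by rewrite /ampW; ring.
- by rewrite /ampW; ring.
Qed.

Lemma ampD1 j : ampD j 1 = im * w j.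
Proof. by rewrite /ampD -mpolyC1 !mderivC subrr add0r mpolyC1 mulr1. Qed.

Lemma dotop_ampD1 :
  [/\ dotop opD opD 1 = - 1 * dotp w w * 1,
      dotop opU opD 1 = im * dotp w u * 1 &
      dotop opZ opD 1 = im * dotp w z * 1].
Proof.
split; apply: dotopE => j; rewrite ampD1.
- rewrite /ampD !(mderiv_mulC, mderivXU, amp_indices) -imM mulr0n; ring.
- by rewrite /ampU; ring.
- by rewrite /ampZ; ring.
Qed.

(** The identity F e = G e. *)
Lemma ampF1_ampG1 lam mu : ampF lam mu 1 = ampG lam mu 1.
Proof.
have f1 : free_of_w 1 by rewrite -mpolyC1; apply: free_of_wC.
have sqfree (x : 'I_n -> W) :
    (forall j, free_of_w (x j)) -> free_of_w (-1 * dotp x x * 1).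
  move=> x0; rewrite mulr1 -mpolyCN -?mpolyC1; apply: (free_of_wM (free_of_wC _)).
  move=> j; rewrite raddf_sum big1 // => l _; exact: (free_of_wM (x0 l) (x0 l)).
have [XX1 XY1 YY1 _ _] := dotop_free f1.
have [XXYY _ _ WXYY _] := dotop_free (sqfree _ free_of_wz).
have [_ _ _ _ WYXX] := dotop_free (sqfree _ free_of_wu).
have [DD1 UD1 ZD1] := dotop_ampD1.
have WW g : dotop opW opW g = 1 * dotp w w * g.
  by apply: dotopE => j; rewrite /ampW; ring.
have UU g : dotop opU opU g = 1 * dotp u u * g.
  by apply: dotopE => j; rewrite /ampU; ring.
have ZZ g : dotop opZ opZ g = 1 * dotp z z * g.
  by apply: dotopE => j; rewrite /ampZ; ring.
have UZ g : dotop opU opZ g = 1 * dotp u z * g.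
  by apply: dotopE => j; rewrite /ampU /ampZ; ring.
apply: wordF_eq_wordG.
- rewrite YY1 XXYY WW DD1 ZZ UU; ring.
- rewrite YY1 WXYY UD1 ZZ; ring.
- rewrite XX1 WYXX ZD1 UU; ring.
- rewrite XX1 UU; ring.
- rewrite XY1 UZ; ring.
- rewrite YY1 ZZ; ring.
Qed.

Fixpoint amplitude lam mu k : W :=
  if k is k'.+1 then ampF (lam + k'%:R) (mu + k'%:R) (amplitude lam mu k') else 1.

(** F_k G_0 ... G_(k-1) 1 = G_0 ... G_(k-1) F_k 1, and F_k 1 = G_k 1. *)
Lemma amplitudeE lam mu k : amplitude lam mu k = ampG_iter lam mu k 1.
Proof.
by elim: k => //= k ->; rewrite ampG_iter_ampF ampF1_ampG1.
Qed.

End Exchange.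

(** * The recursion for the symbols *)

Section SymbolOperators.
Context {R : realType} {n : nat}.
Local Notation C := R[i].
Local Notation S := {mpoly C[n + n]}.

Definition symU (j : 'I_n) (f : S) : S := 'X_(lshift n j) * f.
Definition symZ (j : 'I_n) (f : S) : S := 'X_(rshift n j) * f.
Definition symD (j : 'I_n) (f : S) : S := f^`M(lshift n j) - f^`M(rshift n j).

End SymbolOperators.

Section DiagonalRestriction.
Context {R : realType} {n : nat}.
Local Notation C := R[i].
Local Notation W := {mpoly C[n + (n + n)]}.
Local Notation iw := (@lshift n (n + n)).
Local Notation opW := (@ampW R n).
Local Notation opX := (@ampX R n).
Local Notation opY := (@ampY R n).
Local Notation opU := (@ampU R n).
Local Notation opZ := (@ampZ R n).
Local Notation opD := (@ampD R n).
Local Notation S := {mpoly C[n + n]}.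
Local Notation sU := (@symU R n).
Local Notation sZ := (@symZ R n).
Local Notation sD := (@symD R n).
Local Notation symG_iter := (wordG_iter sU sZ sD).
Local Notation ampG_iter := (wordG_iter opU opZ opD).

(** The substitution w = 0, keeping xi and zeta. *)
Definition w0_point : (n + (n + n)).-tuple S :=
  [tuple (match fintype.split l with inl _ => 0 | inr k => 'X_k end) | l < n + (n + n)].

Local Notation at_w0 := (comp_mpoly w0_point).

Lemma at_w0XU l :
  at_w0 'X_l = match fintype.split l with inl _ => 0 | inr k => 'X_k end.
Proof. by rewrite comp_mpolyXU -tnth_nth tnth_mktuple. Qed.

Lemma at_w0w j : at_w0 'X_(iw j) = 0.
Proof. by rewrite at_w0XU (unsplitK (inl j)). Qed.

Lemma at_w0r l : at_w0 'X_(rshift n l) = 'X_l.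
Proof. by rewrite at_w0XU (unsplitK (inr l)). Qed.

Lemma at_w0_mderiv l f : at_w0 f^`M(rshift n l) = (at_w0 f)^`M(l).
Proof.
move: f; apply: mpoly_gen_ind => [c|i|p q IHp IHq|p q IHp IHq].
- by rewrite mderivC raddf0 comp_mpolyC mderivC.
- rewrite mderivXU rmorph_nat at_w0XU -(splitK i) unsplitK.
  case: (fintype.split i) => k /=.
    by rewrite mderiv0 eq_shift.
  by rewrite mderivXU eq_shift.
- by rewrite mderivD !comp_mpolyD mderivD IHp IHq.
- rewrite mderivM comp_mpolyD 3!(rmorphM (comp_mpoly w0_point)) /=.
  by rewrite mderivM IHp IHq.
Qed.

(** D_j differentiates in xi and zeta only, so that D_j + i w_j restricts to D_j. *)
Lemma at_w0_ampG_iter lam mu k f :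
  at_w0 (ampG_iter lam mu k f) =
  symG_iter lam mu k (at_w0 f).
Proof.
have : intertwines (at_w0 : {linear W -> S}) (ampG_iter lam mu k)
   (symG_iter lam mu k).
  apply: intertwines_wordG_iter => j g /=.
  - by rewrite /ampU rmorphM /= at_w0r.
  - by rewrite /ampZ rmorphM /= at_w0r.
  - rewrite /ampD comp_mpolyD comp_mpolyB !rmorphM /= at_w0w mul0r mulr0 addr0.
    by rewrite !at_w0_mderiv.
by apply.
Qed.

Lemma amplitude_at_w0 lam mu k :
  at_w0 (amplitude lam mu k) =
  symG_iter lam mu k 1.
Proof. by rewrite amplitudeE at_w0_ampG_iter rmorph1. Qed.

End DiagonalRestriction.

Section Homogeneity.
Context {R : realType} {n : nat}.
Local Notation C := R[i].
Local Notation S := {mpoly C[n + n]}.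
Local Notation sU := (@symU R n).
Local Notation sZ := (@symZ R n).
Local Notation sD := (@symD R n).
Local Notation symG := (wordG sU sZ sD).
Local Notation symG_iter := (wordG_iter sU sZ sD).

Lemma dhomog_dotop (A B : 'I_n -> S -> S) d (f : S) :
  (forall j, A j (B j f) \is d.-homog) -> dotop A B f \is d.-homog.
Proof. by move=> h; apply: rpred_sum => j _; apply: h. Qed.

Lemma dhomog_symUU d (f : S) : f \is d.-homog -> dotop sU sU f \is d.+2.-homog.
Proof. by move=> hf; apply: dhomog_dotop => j; do 2!apply: (dhomogM (dhomogXU _)). Qed.

Lemma dhomog_symZZ d (f : S) : f \is d.-homog -> dotop sZ sZ f \is d.+2.-homog.
Proof. by move=> hf; apply: dhomog_dotop => j; do 2!apply: (dhomogM (dhomogXU _)). Qed.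

Lemma dhomog_symUZ d (f : S) : f \is d.-homog -> dotop sU sZ f \is d.+2.-homog.
Proof. by move=> hf; apply: dhomog_dotop => j; do 2!apply: (dhomogM (dhomogXU _)). Qed.

Lemma dhomog_symUD d (f : S) : f \is d.-homog -> dotop sU sD f \is d.-homog.
Proof.
move=> hf; apply: dhomog_dotop => j; rewrite /symU mulrBr.
by apply: rpredB; apply: dhomogM_mderiv hf; apply: dhomogXU.
Qed.

Lemma dhomog_symZD d (f : S) : f \is d.-homog -> dotop sZ sD f \is d.-homog.
Proof.
move=> hf; apply: dhomog_dotop => j; rewrite /symZ mulrBr.
by apply: rpredB; apply: dhomogM_mderiv hf; apply: dhomogXU.
Qed.

Lemma dhomog_symD d j (f : S) : f \is d.-homog -> symD j f \is d.-1.-homog.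
Proof. by move=> hf; apply: rpredB; apply: dhomog_mderiv. Qed.

(** D twice lowers the degree 2k by two and the four factors raise it by four; for k = 0
    the degree cannot drop, but the term is zero. *)
Lemma dhomog_symUUZZDD k (f : S) : f \is (2 * k).-homog ->
  dotop sU sU (dotop sZ sZ (dotop sD sD f)) \is (2 * k.+1).-homog.
Proof.
case: k => [|k] hf.
  have -> : dotop sD sD f = 0.
    rewrite /dotop big1 // => j _; rewrite {2}/symD !mderiv_dhomog0 // subrr.
    by rewrite /symD !mderiv0 subrr.
  have Z0 : dotop sZ sZ 0 = 0.
    by rewrite /dotop big1 // => j _; rewrite /symZ !mulr0.
  have U0 : dotop sU sU 0 = 0.
    by rewrite /dotop big1 // => j _; rewrite /symU !mulr0.
  by rewrite Z0 U0 rpred0.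
have eq2S l : (2 * l.+1 = (2 * l).+2)%N by rewrite mulnS.
rewrite eq2S in hf; rewrite !eq2S; apply/dhomog_symUU/dhomog_symZZ.
by apply: dhomog_dotop => j; apply: (dhomog_symD j (dhomog_symD j hf)).
Qed.

Lemma dhomog_symG lam mu k (f : S) :
  f \is (2 * k).-homog -> symG lam mu f \is (2 * k.+1).-homog.
Proof.
move=> hf; rewrite /wordG.
have := dhomog_symUUZZDD hf; rewrite mulnS => UUZZDD.
have ZZUD := dhomog_symZZ (dhomog_symUD hf).
have UUZD := dhomog_symUU (dhomog_symZD hf).
have UUf := dhomog_symUU hf.
have ZZf := dhomog_symZZ hf.
have UZf := dhomog_symUZ hf.
apply: rpredB (rpredZ _ ZZf); apply: rpredD (rpredZ _ UZf); apply: rpredB (rpredZ _ UUf).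
apply: rpredD (rpredZ _ UUZD); apply: rpredB (rpredZ _ ZZUD).
exact: rpredNr UUZZDD.
Qed.

Lemma dhomog_symG_iter lam mu k l (f : S) :
  f \is (2 * l).-homog -> symG_iter lam mu k f \is (2 * (k + l)).-homog.
Proof.
elim: k l f => //= k IHk l f hf.
by rewrite addSnnS; apply: IHk; apply: dhomog_symG.
Qed.

End Homogeneity.

(** The computation of [conjD_conjD] with X = |xi|^2, Y = |zeta|^2, x = xi_j, y = zeta_j,
    where D_j X = 2 x, D_j Y = - 2 y, D_j x = 1, D_j y = -1, and D1, D2 are D_j g,
    D_j D_j g. *)
Lemma conjugate_square_identity (K : comNzRingType) (A B g x y X Y D1 D2 : K) :
  X * Y *
  ((2 * x * Y + X * (-2 * y)) * D1 + X * Y * D2 +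
   (0 * (x * Y * g) + 2 * A * ((1 * Y + x * (-2 * y)) * g + x * Y * D1)) -
   (0 * (y * X * g) + 2 * B * ((-1 * X + y * (2 * x)) * g + y * X * D1))) +
  2 * (A - 1) *
  (x * Y * (X * Y * D1 + 2 * A * (x * Y * g) - 2 * B * (y * X * g))) -
  2 * (B - 1) *
  (y * X * (X * Y * D1 + 2 * A * (x * Y * g) - 2 * B * (y * X * g))) =
  X * Y *
  (X * Y * D2 + 4 * A * (Y * (x * D1)) - 4 * B * (X * (y * D1)) +
   2 * A * Y * g + 2 * B * X * g - 8 * A * B * (x * y * g)) +
  4 * A * (A - 1) * (Y * Y * g) * (x * x) +
  4 * B * (B - 1) * (X * X * g) * (y * y).
Proof. by ring. Qed.

Section ConjugatedDerivative.
Context {R : realType} {n : nat}.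
Local Notation C := R[i].
Local Notation S := {mpoly C[n + n]}.
Local Notation sU := (@symU R n).
Local Notation sZ := (@symZ R n).
Local Notation sD := (@symD R n).
Local Notation symG := (wordG sU sZ sD).
Local Notation xx := (\sum_(j < n) 'X_(lshift n j) * 'X_(lshift n j) : S).
Local Notation yy := (\sum_(j < n) 'X_(rshift n j) * 'X_(rshift n j) : S).

(** D_j (f |xi|^(2a) |zeta|^(2b)) = (conjD a b j f) |xi|^(2(a-1)) |zeta|^(2(b-1));
    lowering both exponents by one keeps the coefficient polynomial. *)
Definition conjD (a b : C) (j : 'I_n) (f : S) : S :=
  xx * yy * symD j f + (2 * a)%:MP * ('X_(lshift n j) * yy * f)
  - (2 * b)%:MP * ('X_(rshift n j) * xx * f).

Lemma symDM j (f g : S) : symD j (f * g) = symD j f * g + f * symD j g.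
Proof. by rewrite /symD !mderivM; ring. Qed.

Lemma symDD j (f g : S) : symD j (f + g) = symD j f + symD j g.
Proof. by rewrite /symD !mderivD; ring. Qed.

Lemma symDN j (f : S) : symD j (- f) = - symD j f.
Proof. by rewrite /symD !mderivN; ring. Qed.

Lemma symDC (j : 'I_n) (c : C) : symD j (c%:MP : S) = 0.
Proof. by rewrite /symD !mderivC subrr. Qed.

Lemma symDx (j l : 'I_n) : symD j ('X_(lshift n l) : S) = (l == j)%:R.
Proof. by rewrite /symD !mderivXU !eq_shift subr0. Qed.

Lemma symDy (j l : 'I_n) : symD j ('X_(rshift n l) : S) = - (l == j)%:R.
Proof. by rewrite /symD !mderivXU !eq_shift sub0r. Qed.

Lemma symD_sum (j : 'I_n) (F : 'I_n -> S) : symD j (\sum_l F l) = \sum_l symD j (F l).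
Proof. by rewrite /symD !(raddf_sum (mderiv _)) -sumrB. Qed.

Lemma symDxx (j : 'I_n) : symD j xx = 2 * 'X_(lshift n j).
Proof.
rewrite symD_sum (bigD1 j) //= big1 ?addr0 => [|l /negPf lj]; rewrite symDM symDx.
  by rewrite eqxx mulr1n; ring.
by rewrite lj mulr0n; ring.
Qed.

Lemma symDyy (j : 'I_n) : symD j yy = - 2 * 'X_(rshift n j).
Proof.
rewrite symD_sum (bigD1 j) //= big1 ?addr0 => [|l /negPf lj]; rewrite symDM symDy.
  by rewrite eqxx mulr1n; ring.
by rewrite lj mulr0n; ring.
Qed.

Lemma conjD_conjD a b j (f : S) :
  conjD (a - 1) (b - 1) j (conjD a b j f) =
  let x : S := 'X_(lshift n j) in let y : S := 'X_(rshift n j) in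
  xx * yy * (xx * yy * symD j (symD j f)
     + (4 * a)%:MP * (yy * (x * symD j f)) - (4 * b)%:MP * (xx * (y * symD j f))
     + (2 * a)%:MP * yy * f + (2 * b)%:MP * xx * f
     - (8 * a * b)%:MP * (x * y * f))
  + (4 * a * (a - 1))%:MP * (yy * yy * f) * (x * x)
  + (4 * b * (b - 1))%:MP * (xx * xx * f) * (y * y).
Proof.
rewrite /= /conjD.
(* Naming the derivatives keeps symDD from distributing inside symD j f itself. *)
have [D1 D1E] : {D1 | D1 = symD j f} by exists (symD j f).
rewrite -D1E.
have [D2 D2E] : {D2 | D2 = symD j D1} by exists (symD j D1).
rewrite -?D2E !(symDD, symDN, symDM, symDC, symDxx, symDyy, symDx, symDy) eqxx.
rewrite mulr1n -?D2E.
rewrite !(mpolyCM, mpolyCB, mpolyC1, mpolyC_nat).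
rewrite -?D1E -?D2E.
exact: conjugate_square_identity.
Qed.

(** For a single j the remainder after division by |xi|^2 |zeta|^2 is a multiple of
    xi_j^2 |zeta|^4 plus a multiple of zeta_j^2 |xi|^4; summing over j makes it divisible
    as well, which is why q(D) lowers the exponents by one only. *)
Lemma sum_conjD_conjD lam mu (f : S) :
  let a := lam - n%:R / 2 + 1 in let b := mu - n%:R / 2 + 1 in
  \sum_(j < n) conjD (a - 1) (b - 1) j (conjD a b j f) = xx * yy * - symG lam mu f.
Proof.
move=> a b; under eq_bigr => j _ do rewrite conjD_conjD.
rewrite !big_split /= -!mulr_sumr !big_split /= !sumrN -!mulr_sumr !sumr_const card_ord.
rewrite /wordG.
have -> : 2 * lam - n%:R + 2 = 2 * a by rewrite /a; field.
have -> : 2 * mu - n%:R + 2 = 2 * b by rewrite /b; field.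
have UU g : dotop sU sU g = xx * g.
  by rewrite /dotop mulr_suml; apply: eq_bigr => j _; rewrite /symU mulrA.
have ZZ g : dotop sZ sZ g = yy * g.
  by rewrite /dotop mulr_suml; apply: eq_bigr => j _; rewrite /symZ mulrA.
have UZ : dotop sU sZ f =
    \sum_(j < n) 'X_(lshift n j) * 'X_(rshift n j) * f.
  by apply: eq_bigr => j _; rewrite /symU /symZ mulrA.
rewrite !UU !ZZ UZ /dotop /symU /symZ {UU ZZ UZ}.
have -> : lam = a - 1 + n%:R / 2 by rewrite /a; field.
have -> : mu = b - 1 + n%:R / 2 by rewrite /b; field.
have -> : 2 * (a - 1 + n%:R / 2) * (2 * a) = 4 * a * (a - 1) + 2 * a * n%:R by field.
have -> : 2 * (b - 1 + n%:R / 2) * (2 * b) = 4 * b * (b - 1) + 2 * b * n%:R by field.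
rewrite -[f *+ n]mulr_natl.
move: (\sum_(j < n) symD j (symD j f)) (\sum_(j < n) 'X_(lshift n j) * symD j f)
  (\sum_(j < n) 'X_(rshift n j) * symD j f)
  (\sum_(j < n) 'X_(lshift n j) * 'X_(rshift n j) * f).
move: xx yy f a b => X Y g a b DD UD ZD XYf.
rewrite -!mul_mpolyC !(mpolyCM, mpolyCD, mpolyCB, mpolyCN, mpolyC1, mpolyC_nat).
move: (a%:MP : S) (b%:MP : S) => A B; ring.
Qed.

End ConjugatedDerivative.

(** * Plane waves *)

Section ChainRule.
Context {R : realType}.
Local Notation C := R[i].

(** The chain rule for a polynomial in differentiable functions. *)
Lemma is_cderiv_meval (V : normedModType R) m (v p : V) (x : V -> 'I_m -> C)
    (d : 'I_m -> C) :
  (forall l, is_cderiv v (fun q => x q l) p (d l)) ->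
  forall Q : {mpoly C[m]},
  is_cderiv v (fun q => Q.@[x q]) p (\sum_l Q^`M(l).@[x p] * d l).
Proof.
move=> dx; apply: mpoly_gen_ind => [c|i|P Q IHP IHQ|P Q IHP IHQ].
- rewrite big1 => [|l _]; last by rewrite mderivC meval0 mul0r.
  have := is_cderiv_cst v p c; congr is_cderiv.
  by apply/funext => q; rewrite mevalC.
- rewrite (bigD1 i) //= big1 => [|l /negPf li]; last first.
    by rewrite mderivXU eq_sym li mulr0n meval0 mul0r.
  rewrite mderivXU eqxx meval1 mul1r addr0.
  have := dx i; congr is_cderiv.
  by apply/funext => q; rewrite mevalXU.
- have := is_cderivD IHP IHQ; rewrite -big_split /=; congr is_cderiv.
    by apply/funext => q; rewrite mevalD.
  by apply: eq_bigr => l _; rewrite mderivD mevalD mulrDl.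
- have := is_cderivM IHP IHQ; rewrite mulr_suml mulr_sumr -big_split /=; congr is_cderiv.
    by apply/funext => q; rewrite mevalM.
  by apply: eq_bigr => l _; rewrite mderivM mevalD !mevalM; ring.
Qed.

Lemma sum_pick m (i : 'I_m) (F : 'I_m -> C) c : \sum_l F l * ((l == i)%:R * c) = F i * c.
Proof.
rewrite (bigD1 i) //= eqxx mul1r big1 ?addr0 // => l /negPf ->.
by rewrite mulr0n mul0r mulr0.
Qed.

End ChainRule.

Section PlaneWaves.
Context {R : realType} {n : nat} (xi zeta : 'rV[R]_n).
Local Notation E := ('rV[R]_n * 'rV[R]_n)%type.
Local Notation C := R[i].
Local Notation W := {mpoly C[n + (n + n)]}.
Implicit Types (p v : E) (Q : W).
Local Notation iw := (@lshift n (n + n)).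
Local Notation ixi j := (@rshift n (n + n) (@lshift n n j)).
Local Notation ize j := (@rshift n (n + n) (@rshift n n j)).
Local Notation opW := (@ampW R n).
Local Notation opX := (@ampX R n).
Local Notation opY := (@ampY R n).

Definition amp_point p (l : 'I_(n + (n + n))) : C :=
  row_mx (cvec (p.1 - p.2)) (row_mx (cvec xi) (cvec zeta)) 0 l.

Definition amp_wave Q : E -> C := fun p => Q.@[amp_point p] * planewave xi zeta p.

Lemma amp_point_w p j : amp_point p (iw j) = (p.1 0 j - p.2 0 j)%:C.
Proof. by rewrite /amp_point row_mxEl !mxE. Qed.

Lemma amp_point_xi p j : amp_point p (ixi j) = (xi 0 j)%:C.
Proof. by rewrite /amp_point row_mxEr row_mxEl !mxE. Qed.

Lemma amp_point_ze p j : amp_point p (ize j) = (zeta 0 j)%:C.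
Proof. by rewrite /amp_point !row_mxEr !mxE. Qed.

Lemma is_cderiv_amp_point v p l : is_cderiv v (fun q => amp_point q l) p
  (row_mx (cvec (v.1 - v.2)) 0 0 l).
Proof.
case: (split_ordP l) => [j|j] -> {l}.
  rewrite row_mxEl mxE.
  have -> : (fun q => amp_point q (iw j)) = fun q => ((q.1 - q.2) 0 j)%:C.
    by apply/funext => q; rewrite /amp_point row_mxEl mxE.
  apply: is_cderiv_real.
  by apply: is_derive_linear => t q r; rewrite /= !mxE; ring.
rewrite row_mxEr mxE.
have -> : (fun q => amp_point q (rshift n j)) = fun=> row_mx (cvec xi) (cvec zeta) 0 j.
  by apply/funext => q; rewrite /amp_point row_mxEr.
exact: is_cderiv_cst.
Qed.

Lemma is_cderiv_planewave v p : is_cderiv v (planewave xi zeta) p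
  ('i%C * (dotv v.1 xi + dotv v.2 zeta)%:C * planewave xi zeta p).
Proof.
apply: is_cderiv_cexp; apply: is_cderiv_eq.
  apply: is_cderivM; first exact: is_cderiv_cst.
  apply: is_cderiv_real; apply: is_derive_linear => t q r.
  rewrite /= /dotv mulrDr addrACA !mulr_sumr.
  by congr (_ + _); rewrite -big_split; apply: eq_bigr => j _; rewrite !mxE /=; ring.
by rewrite mul0r add0r.
Qed.

Lemma is_cderiv_amp_wave Q v p : is_cderiv v (amp_wave Q) p
  ((\sum_l Q^`M(l).@[amp_point p] * row_mx (cvec (v.1 - v.2)) 0 0 l
   + 'i%C * (dotv v.1 xi + dotv v.2 zeta)%:C * Q.@[amp_point p]) * planewave xi zeta p).
Proof.
apply: is_cderiv_eq.
  exact: (is_cderivM (is_cderiv_meval (is_cderiv_amp_point v p) Q)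
    (is_cderiv_planewave v p)).
by rewrite /=; ring.
Qed.

Lemma dotv_delta j (x : 'rV[R]_n) : dotv (delta_mx 0 j) x = x 0 j.
Proof.
rewrite /dotv (bigD1 j) //= big1 ?addr0 => [|l /negPf lj];
  rewrite mxE eqxx ?eqxx ?mul1r //=.
by rewrite lj mul0r.
Qed.

Lemma dotv0 (x : 'rV[R]_n) : dotv 0 x = 0.
Proof. by rewrite /dotv big1 // => j _; rewrite mxE mul0r. Qed.

(** Used for c = 1 and c = -1: w = x - y moves in opposite directions along d/dx_j
    and d/dy_j. *)
Lemma row_delta j l (c : R) :
  row_mx (cvec (c *: delta_mx 0 j)) (0 : 'rV[C]_(n + n)) 0 l = (l == iw j)%:R * c%:C.
Proof.
case: (split_ordP l) => [i|i] ->.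
  rewrite row_mxEl !mxE eqxx /= eq_shift rmorphM rmorph_nat mulrC; by case: eqP.
by rewrite row_mxEr mxE eq_shift mulr0n mul0r.
Qed.

Lemma dx_amp_wave j Q : dx j (amp_wave Q) = amp_wave (ampX j Q).
Proof.
apply/funext => p; rewrite /dx (cderivE (is_cderiv_amp_wave _ _ _)) /=.
rewrite subr0 -[delta_mx 0 j]scale1r; under eq_bigr do rewrite row_delta.
rewrite sum_pick scale1r dotv_delta dotv0 addr0 /amp_wave /ampX.
by rewrite mevalD !mevalM mevalC mevalXU amp_point_xi; ring.
Qed.

Lemma dy_amp_wave j Q : dy j (amp_wave Q) = amp_wave (ampY j Q).
Proof.
apply/funext => p; rewrite /dy (cderivE (is_cderiv_amp_wave _ _ _)) /=.
rewrite sub0r -[- delta_mx 0 j]scaleN1r; under eq_bigr do rewrite row_delta.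
rewrite sum_pick dotv_delta dotv0 add0r /amp_wave /ampY rmorphN1.
by rewrite mevalB !mevalM mevalC mevalXU amp_point_ze; ring.
Qed.

Lemma amp_wave_sum (F : 'I_n -> W) p : amp_wave (\sum_j F j) p = \sum_j amp_wave (F j) p.
Proof. by rewrite /amp_wave raddf_sum mulr_suml. Qed.

Lemma lapx_amp_wave Q : lapx (amp_wave Q) = amp_wave (dotop opX opX Q).
Proof.
apply/funext => p; rewrite /lapx amp_wave_sum.
by apply: eq_bigr => j _; rewrite !dx_amp_wave.
Qed.

Lemma lapy_amp_wave Q : lapy (amp_wave Q) = amp_wave (dotop opY opY Q).
Proof.
apply/funext => p; rewrite /lapy amp_wave_sum.
by apply: eq_bigr => j _; rewrite !dy_amp_wave.
Qed.

Lemma nablaxy_amp_wave Q : nablaxy (amp_wave Q) = amp_wave (dotop opX opY Q).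
Proof.
apply/funext => p; rewrite /nablaxy amp_wave_sum.
by apply: eq_bigr => j _; rewrite dy_amp_wave dx_amp_wave.
Qed.

Lemma enorm_sqr (x : 'rV[R]_n) : enorm x ^+ 2 = dotv x x.
Proof.
by rewrite sqr_sqrtr //; apply: sumr_ge0 => j _; rewrite -expr2 sqr_ge0.
Qed.

Lemma amp_waveW j Q p : amp_wave (ampW j Q) p = (p.1 0 j - p.2 0 j)%:C * amp_wave Q p.
Proof. by rewrite /amp_wave /ampW mevalM mevalXU amp_point_w mulrA. Qed.

Lemma opF_amp_wave lam mu Q :
  opF lam mu (amp_wave Q) = amp_wave (wordF opW opX opY lam mu Q).
Proof.
apply/funext => p; rewrite /opF lapx_amp_wave lapy_amp_wave nablaxy_amp_wave.
have waveD P P' : amp_wave (P + P') p = amp_wave P p + amp_wave P' p.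
  by rewrite /amp_wave mevalD mulrDl.
have waveN P : amp_wave (- P) p = - amp_wave P p.
  by rewrite /amp_wave mevalN mulNr.
have waveZ c P : amp_wave (c *: P) p = c * amp_wave P p.
  by rewrite /amp_wave mevalZ mulrA.
rewrite /wordF !(waveD, waveN, waveZ) lapx_amp_wave.
have -> : amp_wave (dotop opW opW
    (dotop opX opX (dotop opY opY Q))) p =
  (enorm (p.1 - p.2) ^+ 2)%:C *
  amp_wave (dotop opX opX (dotop opY opY Q)) p.
  rewrite amp_wave_sum enorm_sqr /dotv rmorph_sum mulr_suml; apply: eq_bigr => j _.
  by rewrite !amp_waveW !mxE rmorphM mulrA.
have -> : amp_wave (dotop opW opX (dotop opY opY Q)) p =
  \sum_(j < n) (p.1 0 j - p.2 0 j)%:C *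
     dx j (amp_wave (dotop opY opY Q)) p.
  by rewrite amp_wave_sum; apply: eq_bigr => j _; rewrite amp_waveW dx_amp_wave.
have -> : amp_wave (dotop opW opY (dotop opX opX Q)) p =
  - \sum_(j < n) (p.2 0 j - p.1 0 j)%:C *
     dy j (amp_wave (dotop opX opX Q)) p.
  rewrite amp_wave_sum -sumrN; apply: eq_bigr => j _.
  by rewrite amp_waveW dy_amp_wave -mulNr -rmorphN opprB.
by rewrite mulrN opprK.
Qed.

Lemma amp_wave1 : amp_wave 1 = planewave xi zeta.
Proof. by apply/funext => p; rewrite /amp_wave meval1 mul1r. Qed.

Lemma opFiter_planewave k lam mu :
  opFiter k lam mu (planewave xi zeta) = amp_wave (amplitude lam mu k).
Proof. by elim: k => [|k /= ->]; rewrite /= ?amp_wave1 // opF_amp_wave. Qed.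

(** On the diagonal w = 0. *)
Lemma amp_wave_diag Q x :
  amp_wave Q (x, x) =
  peval (comp_mpoly w0_point Q) (cvec xi) (cvec zeta) * planewave xi zeta (x, x).
Proof.
rewrite /amp_wave /peval comp_mpoly_meval; congr (_ * _); apply: meval_eq => l.
rewrite tnth_mktuple /amp_point subrr; case: (split_ordP l) => [j|j] ->.
  by rewrite meval0 row_mxEl !mxE.
by rewrite mevalXU row_mxEr.
Qed.

End PlaneWaves.

Lemma is_symbol_opB (R : realType) n (lam mu : R[i]) k :
  is_symbol (opB k lam mu) (wordG_iter (@symU R n) (@symZ R n) (@symD R n) lam mu k 1).
Proof.
by move=> xi zeta x; rewrite /opB /res opFiter_planewave amp_wave_diag amplitude_at_w0.
Qed.

(** * The polynomials p_k *)

Section Powers.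
Context {R : realType} {n : nat}.
Local Notation E := ('rV[R]_n * 'rV[R]_n)%type.
Local Notation C := R[i].
Local Notation S := {mpoly C[n + n]}.
Local Notation sU := (@symU R n).
Local Notation sZ := (@symZ R n).
Local Notation sD := (@symD R n).
Local Notation symG := (wordG sU sZ sD).
Implicit Types (F : S) (a b : C).

Lemma dotv_gt0 (x : 'rV[R]_n) : x != 0 -> 0 < dotv x x.
Proof.
move=> x0; rewrite lt_neqAle sumr_ge0 => [|j _]; last by rewrite -expr2 sqr_ge0.
rewrite andbT eq_sym; apply: contraNneq x0 => /psumr_eq0P x0.
apply/eqP/rowP => j; rewrite mxE; apply/eqP; rewrite -sqrf_eq0 expr2.
by rewrite x0 // => i _; rewrite -expr2 sqr_ge0.
Qed.

Lemma ln_sqrt (y : R) : 0 < y -> ln (Num.sqrt y) = 2^-1 * ln y.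
Proof.
move=> y0; rewrite -{2}(sqr_sqrtr (ltW y0)) lnXn ?sqrtr_gt0 //.
by rewrite -[ln _ *+ 2]mulr_natl mulrA mulVf ?mul1r ?pnatr_eq0.
Qed.

(** ln |x| = ln (x.x) / 2 holds only where x is nonzero, hence the assumption near p. *)
Lemma is_derive_ln_enorm (V : normedModType R) (v p : V) (x : V -> 'rV[R]_n) :
  (forall (t : R) q r, x (t *: q + r) = t *: x q + x r) ->
  (\forall q \near p, x q != 0) ->
  is_derive p v (fun q => ln (enorm (x q))) (dotv (x v) (x p) / dotv (x p) (x p)).
Proof.
move=> xlin near0.
have xp0 : 0 < dotv (x p) (x p) by apply: dotv_gt0; apply: nbhs_singleton near0.
have dcoord j : is_derive p v (fun q => x q 0 j) (x v 0 j).
  by apply: is_derive_linear => t q r; rewrite xlin !mxE.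
have dsq : is_derive p v (fun q => dotv (x q) (x q)) (2 * dotv (x v) (x p)).
  have := is_derive_sum (fun j => is_deriveM (dcoord j) (dcoord j)).
  rewrite (_ : \sum_(i < n) _ = fun q => dotv (x q) (x q)); last first.
    by apply/funext => q; rewrite fct_sumE.
  move/is_derive_eq; apply; rewrite /dotv mulr_sumr; apply: eq_bigr => j _.
  by rewrite /GRing.scale /=; ring.
have dln := is_deriveM (is_derive_cst (2^-1 : R) p v)
  (@is_derive_comp1 _ _ v p (@ln R) (fun q => dotv (x q) (x q)) _ _
    (is_derive1_ln xp0) dsq).
apply: (@near_eq_is_derive _ _ _ (cst (2^-1 : R) * (fun q => ln (dotv (x q) (x q))))).
  apply: filterS near0 => q q0.
  by rewrite /enorm ln_sqrt // dotv_gt0.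
apply: is_derive_eq dln _.
by rewrite /GRing.scale /=; field; rewrite gt_eqF.
Qed.

Definition offaxes : pred E := fun p => (p.1 != 0) && (p.2 != 0).

Lemma near_fst_neq0 (p : E) : p.1 != 0 -> \forall q \near p, q.1 != 0.
Proof.
case: p => x y /= x0.
by apply: (@cvgr_neq0 R 'rV[R]_n E (nbhs (x, y)) _ fst x) => //; exact: cvg_fst.
Qed.

Lemma near_snd_neq0 (p : E) : p.2 != 0 -> \forall q \near p, q.2 != 0.
Proof.
case: p => x y /= y0.
by apply: (@cvgr_neq0 R 'rV[R]_n E (nbhs (x, y)) _ snd y) => //; exact: cvg_snd.
Qed.

Lemma near_offaxes p : offaxes p -> \forall q \near p, offaxes q.
Proof.
case/andP => /near_fst_neq0 p1 /near_snd_neq0 p2.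
by apply: filterS2 p1 p2 => q q1 q2; apply/andP.
Qed.

Lemma is_cderiv_pow2 a b (v p : E) : offaxes p ->
  is_cderiv v (pow2 a b) p
    ((2 * a * (dotv v.1 p.1 / dotv p.1 p.1)%:C
      + 2 * b * (dotv v.2 p.2 / dotv p.2 p.2)%:C)
     * pow2 a b p).
Proof.
case/andP => /near_fst_neq0 p1 /near_snd_neq0 p2.
have d1 := @is_derive_ln_enorm _ v p (fun q : E => q.1) (fun t q r => erefl) p1.
have d2 := @is_derive_ln_enorm _ v p (fun q : E => q.2) (fun t q r => erefl) p2.
have e1 := is_cderiv_cexp (is_cderivM (is_cderiv_cst v p (2 * a)) (is_cderiv_real d1)).
have e2 := is_cderiv_cexp (is_cderivM (is_cderiv_cst v p (2 * b)) (is_cderiv_real d2)).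
apply: is_cderiv_eq (is_cderivM e1 e2) _.
by rewrite /pow2 /cpow; ring.
Qed.

Lemma cexpD (z w : C) : cexp (z + w) = cexp z * cexp w.
Proof.
case: z w => [z1 z2] [w1 w2]; rewrite /cexp /= expRD cosD sinD.
by apply/eqP; rewrite eq_complex /=; apply/andP; split; apply/eqP; ring.
Qed.

Lemma cexp_real (t : R) : cexp t%:C = (expR t)%:C.
Proof. by rewrite /cexp /= cos0 sin0 mulr1 mulr0. Qed.

Lemma cpow_enorm (x : 'rV[R]_n) a : x != 0 ->
  cpow (enorm x) (2 * a) = (dotv x x)%:C * cpow (enorm x) (2 * (a - 1)).
Proof.
move=> x0; have sq := dotv_gt0 x0.
have -> : (dotv x x)%:C = cexp (2 * ln (enorm x))%:C.
  by rewrite cexp_real ln_sqrt // mulrA divff ?mul1r ?pnatr_eq0 // lnK.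
rewrite -cexpD; congr cexp; rewrite rmorphM rmorph_nat; ring.
Qed.

Lemma pow2_pred a b p : offaxes p ->
  pow2 a b p = (dotv p.1 p.1)%:C * (dotv p.2 p.2)%:C * pow2 (a - 1) (b - 1) p.
Proof.
by case/andP => p1 p2; rewrite /pow2 (cpow_enorm a p1) (cpow_enorm b p2); ring.
Qed.

Definition polypow a b F : E -> C :=
  fun p => peval F (cvec p.1) (cvec p.2) * pow2 a b p.

Lemma is_cderiv_polypow a b F (v p : E) : offaxes p ->
  is_cderiv v (polypow a b F) p
    ((\sum_l peval F^`M(l) (cvec p.1) (cvec p.2) * row_mx (cvec v.1) (cvec v.2) 0 l
      + peval F (cvec p.1) (cvec p.2) *
        (2 * a * (dotv v.1 p.1 / dotv p.1 p.1)%:C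
         + 2 * b * (dotv v.2 p.2 / dotv p.2 p.2)%:C))
     * pow2 a b p).
Proof.
move=> p0.
have dcoord l : is_cderiv v (fun q : E => row_mx (cvec q.1) (cvec q.2) 0 l) p
    (row_mx (cvec v.1) (cvec v.2) 0 l).
  case: (split_ordP l) => j ->.
    have -> : (fun q : E => row_mx (cvec q.1) (cvec q.2) 0 (lshift n j)) =
        fun q => (q.1 0 j)%:C.
      by apply/funext => q; rewrite row_mxEl mxE.
    rewrite row_mxEl mxE; apply: is_cderiv_real.
    by apply: is_derive_linear => t q r; rewrite !mxE.
  have -> : (fun q : E => row_mx (cvec q.1) (cvec q.2) 0 (rshift n j)) =
      fun q => (q.2 0 j)%:C.
    by apply/funext => q; rewrite row_mxEr mxE.
  rewrite row_mxEr mxE; apply: is_cderiv_real.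
  by apply: is_derive_linear => t q r; rewrite !mxE.
apply: is_cderiv_eq (is_cderivM (is_cderiv_meval dcoord F) (is_cderiv_pow2 a b v p0)) _.
by rewrite /peval; ring.
Qed.

Lemma peval_xx (p : E) :
  peval (\sum_(i < n) 'X_(lshift n i) * 'X_(lshift n i)) (cvec p.1) (cvec p.2)
  = (dotv p.1 p.1)%:C.
Proof.
rewrite /peval raddf_sum rmorph_sum; apply: eq_bigr => i _.
by rewrite /= mevalM mevalXU row_mxEl mxE rmorphM.
Qed.

Lemma peval_yy (p : E) :
  peval (\sum_(i < n) 'X_(rshift n i) * 'X_(rshift n i)) (cvec p.1) (cvec p.2)
  = (dotv p.2 p.2)%:C.
Proof.
rewrite /peval raddf_sum rmorph_sum; apply: eq_bigr => i _.
by rewrite /= mevalM mevalXU row_mxEr mxE rmorphM.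
Qed.

Lemma dxy_polypow a b F j p : offaxes p ->
  dxy j (polypow a b F) p = polypow (a - 1) (b - 1) (conjD a b j F) p.
Proof.
move=> p0; have /andP[/dotv_gt0 p1 /dotv_gt0 p2] := p0.
rewrite /dxy /dx /dy !(cderivE (is_cderiv_polypow _ _ _ _ p0)) /=.
rewrite !dotv0 !dotv_delta !mul0r.
have -> : \sum_l peval F^`M(l) (cvec p.1) (cvec p.2) *
    row_mx (cvec (delta_mx 0 j)) (cvec 0) 0 l =
    peval F^`M(lshift n j) (cvec p.1) (cvec p.2).
  rewrite -[RHS]mulr1 -(sum_pick _ (fun l => peval F^`M(l) (cvec p.1) (cvec p.2))).
  apply: eq_bigr => l _; congr (_ * _).
  case: (split_ordP l) => i ->; last by rewrite row_mxEr !mxE eq_shift mulr0n mul0r.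
  by rewrite row_mxEl !mxE eqxx /= eq_shift mulr1 rmorph_nat.
have -> : \sum_l peval F^`M(l) (cvec p.1) (cvec p.2) *
    row_mx (cvec 0) (cvec (delta_mx 0 j)) 0 l =
    peval F^`M(rshift n j) (cvec p.1) (cvec p.2).
  rewrite -[RHS]mulr1 -(sum_pick _ (fun l => peval F^`M(l) (cvec p.1) (cvec p.2))).
  apply: eq_bigr => l _; congr (_ * _).
  case: (split_ordP l) => i ->; first by rewrite row_mxEl !mxE eq_shift mulr0n mul0r.
  by rewrite row_mxEr !mxE eqxx /= eq_shift mulr1 rmorph_nat.
rewrite (pow2_pred a b p0) /polypow /conjD /symD.
have evx := peval_xx p; have evy := peval_yy p; rewrite /peval in evx evy *.
rewrite !(mevalD, mevalB, mevalN, mevalM, mevalC).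
rewrite evx evy !mevalXU row_mxEl row_mxEr !mxE !rmorphM !fmorphV.
have X0 : (dotv p.1 p.1)%:C != 0 by rewrite fmorph_eq0 gt_eqF.
have Y0 : (dotv p.2 p.2)%:C != 0 by rewrite fmorph_eq0 gt_eqF.
by rewrite !rmorph0; field; rewrite X0 Y0.
Qed.

(** The identities below hold on [offaxes] only; being open, this set is large enough to
    differentiate them again. *)
Lemma dxy_local j (f g : E -> C) :
  {in offaxes, f =1 g} -> {in offaxes, dxy j f =1 dxy j g}.
Proof.
move=> fg p p0; have near_fg : \forall q \near p, f q = g q.
  by apply: filterS (near_offaxes p0) => q; apply: fg.
by rewrite /dxy /dx /dy !(near_cderiv _ near_fg).
Qed.

Lemma opq_local (f g : E -> C) : {in offaxes, f =1 g} -> {in offaxes, opq f =1 opq g}.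
Proof.
by move=> fg p p0; apply: eq_bigr => j _; apply: dxy_local p0; apply: dxy_local.
Qed.

Lemma iter_opq_local k (f g : E -> C) :
  {in offaxes, f =1 g} -> {in offaxes, iter k opq f =1 iter k opq g}.
Proof.
move=> fg; elim: k => [|k IHk]; first exact: fg.
exact: (@opq_local (iter k opq f) (iter k opq g) IHk).
Qed.

(** Two applications of D_j lower the exponents by two, and the common factor
    |xi|^2 |zeta|^2 raises them again by one. *)
Lemma opq_polypow lam mu F :
  let a := lam - n%:R / 2 in let b := mu - n%:R / 2 in
  {in offaxes, opq (polypow (a + 1) (b + 1) F) =1 polypow a b (- symG lam mu F)}.
Proof.
move=> a b p p0; have dxy1 j : {in offaxes, dxy j (polypow (a + 1) (b + 1) F) =1
    polypow (a + 1 - 1) (b + 1 - 1) (conjD (a + 1) (b + 1) j F)}.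
  by move=> q q0; apply: dxy_polypow.
rewrite /opq (eq_bigr (fun j => polypow (a + 1 - 1 - 1) (b + 1 - 1 - 1)
   (conjD (a + 1 - 1) (b + 1 - 1) j (conjD (a + 1) (b + 1) j F)) p)); last first.
  by move=> j _; rewrite (dxy_local j (dxy1 j) p0) dxy_polypow.
have -> : \sum_(j < n) polypow (a + 1 - 1 - 1) (b + 1 - 1 - 1)
     (conjD (a + 1 - 1) (b + 1 - 1) j (conjD (a + 1) (b + 1) j F)) p =
   peval (\sum_(j < n) conjD (a + 1 - 1) (b + 1 - 1) j (conjD (a + 1) (b + 1) j F))
     (cvec p.1) (cvec p.2) * pow2 (a + 1 - 1 - 1) (b + 1 - 1 - 1) p.
  by rewrite /peval raddf_sum mulr_suml.
rewrite sum_conjD_conjD !addrK /polypow (pow2_pred a b p0) -peval_xx -peval_yy.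
rewrite /peval !mevalM.
by ring.
Qed.

End Powers.

Section ExistencePk.
Context {R : realType} {n : nat}.
Local Notation C := R[i].
Local Notation S := {mpoly C[n + n]}.
Local Notation sU := (@symU R n).
Local Notation sZ := (@symZ R n).
Local Notation sD := (@symD R n).
Local Notation symG := (wordG sU sZ sD).
Local Notation symG_iter := (wordG_iter sU sZ sD).

Lemma symG_iterZ lam mu k c (F : S) :
  symG_iter lam mu k (c *: F) = c *: symG_iter lam mu k F.
Proof.
have : intertwines ( *:%R c : {linear S -> S}) (symG_iter lam mu k) (symG_iter lam mu k).
  apply: intertwines_wordG_iter => j f /=.
  - exact: scalerAr.
  - exact: scalerAr.
  - by rewrite /symD !mderivZ scalerBr.
by move/(_ F) => /= <-.
Qed.

(** The innermost q(D) meets the largest exponents, so it produces G_(k-1), the innermost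
    factor of [wordG_iter]. *)
Lemma iter_opq_polypow lam mu k (F : S) :
  let a := lam - n%:R / 2 in let b := mu - n%:R / 2 in
  {in @offaxes R n, iter k opq (polypow (a + k%:R) (b + k%:R) F)
     =1 polypow a b ((-1) ^+ k *: symG_iter lam mu k F)}.
Proof.
move=> a b; elim: k F => [|k IHk] F p p0; first by rewrite /= !addr0 scale1r.
rewrite iterSr.
have step : {in @offaxes R n, opq (polypow (a + k.+1%:R) (b + k.+1%:R) F)
    =1 polypow (a + k%:R) (b + k%:R) (- symG (lam + k%:R) (mu + k%:R) F)}.
  move=> q q0; have := opq_polypow (lam + k%:R) (mu + k%:R) F q0.
  by rewrite -[k.+1]addn1 natrD !addrA /a /b ![_ + k%:R - _]addrAC.
rewrite (iter_opq_local k step p0) (IHk _ p p0) -scaleN1r symG_iterZ scalerA.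
by rewrite exprSr.
Qed.

Definition pk_poly lam mu k : S := (-1) ^+ k *: symG_iter lam mu k 1.

Lemma is_pk_pk_poly lam mu k :
  is_pk (lam - n%:R / 2) (mu - n%:R / 2) k (pk_poly lam mu k).
Proof.
split.
  rewrite -[k in (2 * k)%N]addn0; apply: rpredZ; apply: dhomog_symG_iter.
  exact: dhomog1.
move=> xi eta xi0 eta0.
have p0 : (xi, eta) \in @offaxes R n by apply/andP.
have pow2E a b : pow2 a b = polypow a b (1 : S).
  by apply/funext => p; rewrite /polypow /peval meval1 mul1r.
by rewrite {1}pow2E iter_opq_polypow.
Qed.

End ExistencePk.

(** * Uniqueness *)

Section Uniqueness.
Context {R : realType} {n : nat}.
Local Notation C := R[i].

Lemma poly_zero_on_nat (K : numDomainType) (q : {poly K}) :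
  (forall t : nat, q.[t%:R] = 0) -> q = 0.
Proof.
move=> q0; apply/eqP/negP => /negP qn0.
have := @max_poly_roots _ q [seq t%:R | t <- iota 0 (size q)] qn0.
rewrite size_map size_iota ltnn => qroots; have // : false.
apply: qroots; first by apply/allP => _ /mapP[t _ ->]; rewrite /root q0.
by rewrite map_inj_uniq ?iota_uniq // => i j /eqP; rewrite eqr_nat => /eqP.
Qed.

Lemma meval_on_line (K : comNzRingType) m (P : {mpoly K[m]}) (c : 'I_m -> K) :
  exists h : {poly K}, forall t, h.[t] = P.@[fun l => c l + t].
Proof.
move: P; apply: mpoly_gen_ind => [a|i|P Q [h hE] [g gE]|P Q [h hE] [g gE]].
- by exists a%:P => t; rewrite hornerC mevalC.
- by exists ((c i)%:P + 'X) => t; rewrite mevalXU !hornerE.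
- by exists (h + g) => t; rewrite hornerD hE gE mevalD.
- by exists (h * g) => t; rewrite hornerM hE gE mevalM.
Qed.

(** Translate xi and eta by t (1, ..., 1).  For all but at most two natural numbers t both
    first coordinates are nonzero; multiplying by (t + xi_0) (t + eta_0) covers the
    exceptions and leaves a polynomial in t that vanishes at every natural number. *)
Lemma peval_eq0_offaxes (P : cpoly R n) : (0 < n)%N ->
  (forall xi eta : 'rV[R]_n, xi != 0 -> eta != 0 -> peval P (cvec xi) (cvec eta) = 0) ->
  forall xi eta : 'rV[R]_n, peval P (cvec xi) (cvec eta) = 0.
Proof.
move=> n0 P0 xi eta; pose o := Ordinal n0.
have [h hE] := meval_on_line P (fun l => row_mx (cvec xi) (cvec eta) 0 l).
suff h0 : h = 0.
  have := hE 0; rewrite h0 horner0 => ->; apply: meval_eq => l; exact/esym/addr0.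
have Xn0 c : 'X + c%:P != 0 :> {poly C} by rewrite -[c]opprK polyCN polyXsubC_eq0.
suff : h * (('X + ((xi 0 o)%:C)%:P) * ('X + ((eta 0 o)%:C)%:P)) = 0.
  by move/eqP; rewrite !mulf_eq0 !(negPf (Xn0 _)) !orbF => /eqP.
apply: poly_zero_on_nat => t; rewrite !(hornerM, hornerD, hornerX, hornerC).
have shift_neq0 (x : 'rV[R]_n) : t%:R + (x 0 o)%:C != 0 -> x + const_mx t%:R != 0.
  apply: contraNneq => /rowP /(_ o); rewrite !mxE => xt0.
  by rewrite -[t%:R](rmorph_nat (real_complex R)) -rmorphD addrC xt0.
have [->|x0] := eqVneq (t%:R + (xi 0 o)%:C) 0; first by rewrite ?(mulr0, mul0r).
have [->|y0] := eqVneq (t%:R + (eta 0 o)%:C) 0; first by rewrite ?(mulr0, mul0r).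
have -> : h.[t%:R] = peval P (cvec (xi + const_mx t%:R)) (cvec (eta + const_mx t%:R)).
  rewrite hE; apply: meval_eq => l; case: (split_ordP l) => j ->.
    by rewrite !row_mxEl !mxE rmorphD rmorph_nat.
  by rewrite !row_mxEr !mxE rmorphD rmorph_nat.
by rewrite P0 ?mul0r // shift_neq0.
Qed.

Lemma cexp_neq0 (z : C) : cexp z != 0.
Proof.
have zz : cexp z * cexp (- z) = 1 by rewrite -cexpD subrr (cexp_real 0) expR0.
by apply: contra_eq_neq zz => ->; rewrite mul0r eq_sym oner_eq0.
Qed.

Lemma is_pk_unique (al be : C) k (P Q : cpoly R n) (xi eta : 'rV[R]_n) : (0 < n)%N ->
  is_pk al be k P -> is_pk al be k Q ->
  peval P (cvec xi) (cvec eta) = peval Q (cvec xi) (cvec eta).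
Proof.
move=> n0 [_ PE] [_ QE]; apply/eqP; rewrite -subr_eq0 -mevalB; apply/eqP.
apply: (@peval_eq0_offaxes (P - Q)) => // {xi eta} xi eta xi0 eta0.
rewrite /peval mevalB; apply/eqP; rewrite subr_eq0; apply/eqP.
have := PE _ _ xi0 eta0; rewrite QE // => /esym; apply: mulIf.
by rewrite mulf_neq0 ?cexp_neq0.
Qed.

Lemma is_symbol_unique B (P Q : cpoly R n) (xi zeta : 'rV[R]_n) :
  is_symbol B P -> is_symbol B Q ->
  peval P (cvec xi) (cvec zeta) = peval Q (cvec xi) (cvec zeta).
Proof.
move=> /(_ xi zeta 0) PE /(_ xi zeta 0); rewrite PE; apply: mulIf.
exact: cexp_neq0.
Qed.

Lemma meval_dhomogZ (K : comNzRingType) m d (P : {mpoly K[m]}) (c : K) (v : 'I_m -> K) :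
  P \is d.-homog -> P.@[fun l => c * v l] = c ^+ d * P.@[v].
Proof.
move=> /dhomogP Pd; rewrite !mevalE mulr_sumr; apply: eq_big_seq => u /Pd /= ud.
rewrite mulrCA; congr (_ * _); under eq_bigr do rewrite exprMn.
by rewrite big_split /= prodrXr -mdegE ud.
Qed.

End Uniqueness.

Theorem theorem5p2 (R : realType) (n : nat) (hn : (0 < n)%N)
    (lam mu : R[i]) (k : nat) (xi zeta : 'rV[R]_n) :
  peval (symb n lam mu k) (cvec xi) (cvec zeta)
    = peval (pk n (lam - n%:R / 2) (mu - n%:R / 2) k)
        ('i%C *: cvec xi) ('i%C *: cvec zeta)
  /\
  peval (pk n (lam - n%:R / 2) (mu - n%:R / 2) k)
        ('i%C *: cvec xi) ('i%C *: cvec zeta)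
    = (-1) ^+ k *
      peval (pk n (lam - n%:R / 2) (mu - n%:R / 2) k) (cvec xi) (cvec zeta).
Proof.
set p := pk n _ _ k.
have pkP : is_pk (lam - n%:R / 2) (mu - n%:R / 2) k p.
  exact: (xgetI 0 (is_pk_pk_poly lam mu k)).
have symbP : is_symbol (opB k lam mu) (symb n lam mu k).
  exact: (xgetI 0 (@is_symbol_opB R n lam mu k)).
have pki : peval p ('i%C *: cvec xi) ('i%C *: cvec zeta)
    = (-1) ^+ k * peval p (cvec xi) (cvec zeta).
  rewrite -sqr_i -exprM -(meval_dhomogZ _ _ (proj1 pkP)); apply: meval_eq => l.
  by rewrite -scale_row_mx mxE.
split; last exact: pki.
rewrite pki (is_pk_unique _ _ hn pkP (is_pk_pk_poly lam mu k)).
rewrite (is_symbol_unique _ _ symbP (@is_symbol_opB R n lam mu k)).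
by rewrite /pk_poly {2}/peval mevalZ mulrA -expr2 sqrr_sign mul1r.
Qed.
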